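(* Let $\mathcal{G}$ be the strict inductive limit of a sequence of locally convex topological $\widetilde{\mathbb{C}}$-modules $(\mathcal{G}_p)_p$. If on every $\mathcal{G}_p$ there exists a web $\mathcal{W}_p$ of type $\mathcal{C}$, then $\mathcal{G}$ has a web $\mathcal{W}$ of type $\mathcal{C}$. Moreover, if every $\mathcal{W}_p$ is absolutely convex, then $\mathcal{W}$ is absolutely convex (i.e. $\mathcal{W}$ can then be taken absolutely convex).
   Context: Generalized numbers: $\widetilde{\mathbb{C}}=\mathcal{E}_M/\mathcal{N}$, where $\mathcal{E}_M$ is the ring of nets $(c_\varepsilon)_\varepsilon\in\mathbb{C}^{(0,1]}$ with $|c_\varepsilon|=O(\varepsilon^{-N})$ as $\varepsilon\to0$ for some $N\in\mathbb{N}$, and $\mathcal{N}$ is the ideal of nets with $|c_\varepsilon|=O(\varepsilon^{q})$ for all $q\in\mathbb{N}$; $[(c_\varepsilon)_\varepsilon]$ denotes the class of $(c_\varepsilon)_\varepsilon$. The valuation is $\mathrm{v}(c)=\sup\{b\in\mathbb{R}: |c_\varepsilon|=O(\varepsilon^b)\text{ as }\varepsilon\to0\}$ and $|c|_{\mathrm e}=e^{-\mathrm{v}(c)}$; $\widetilde{\mathbb{C}}$ carries the topology of the ultrametric $|c-d|_{\mathrm e}$. A topological $\widetilde{\mathbb{C}}$-module is a $\widetilde{\mathbb{C}}$-module with a ($\widetilde{\mathbb{C}}$-linear) topology making addition and scalar multiplication $\widetilde{\mathbb{C}}\times\mathcal{G}\to\mathcal{G}$ continuous. A subset $A$ of a $\widetilde{\mathbb{C}}$-module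 is balanced if $\lambda A\subseteq A$ whenever $|\lambda|_{\mathrm e}\le1$; convex if $A+A\subseteq A$ and $[(\varepsilon^b)_\varepsilon]A\subseteq A$ for all $b\ge0$; absolutely convex if balanced and convex. A topological $\widetilde{\mathbb{C}}$-module is locally convex if it has a base of convex neighborhoods of $0$. Strict inductive limit: $(\mathcal{G}_p)_{p\ge1}$ is an increasing sequence of submodules of the $\widetilde{\mathbb{C}}$-module $\mathcal{G}$ with $\mathcal{G}=\bigcup_p\mathcal{G}_p$; each $\mathcal{G}_p$ carries a locally convex $\widetilde{\mathbb{C}}$-linear topology $\tau_p$ such that $\tau_{p+1}$ induces $\tau_p$ on $\mathcal{G}_p$; and $\mathcal{G}$ carries the finest locally convex $\widetilde{\mathbb{C}}$-linear topology making all inclusions $\mathcal{G}_p\to\mathcal{G}$ continuous. A web on a locally convex topological $\widetilde{\mathbb{C}}$-module $\mathcal{F}$ is a family $\mathcal{W}=\{C(n_1,\dots,n_k)\}$ of subsets of $\mathcal{F}$, with $k,n_1,\dots,n_k$ running through $\mathbb{N}\setminus0$, such that $\mathcal{F}=\bigcup_{n_1\ge1}C(n_1)$ and $C(n_1,\dots,n_{k-1})=\bigcup_{n_k\ge1}C(n_1,\dots,n_k)$ for all $k>1$ and all $n_1,\dots,n_{k-1}$. The web is absolutely convex if all its sets are. It is of type $\mathcal{C}$ if for every sequence $(n_k)_{k\ge1}$ in $\mathbb{N}\setminus0$ there is a sequence $(\rho_k)_{k\ge1}$ in $\mathbb{R}$ such that for all $\lambda_k\ge\rho_k$ and all $x_k\in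 C(n_1,\dots,n_k)$ ($k\ge1$) the series $\sum_{k=1}^\infty[(\varepsilon^{\lambda_k})_\varepsilon]x_k$ converges in $\mathcal{F}$. *)

(* Defs.v *)
From HB Require Import structures.
From mathcomp Require Import all_boot all_order all_algebra.
From mathcomp Require Import all_classical all_reals all_analysis.
From mathcomp Require Import complex.

Set Implicit Arguments.
Unset Strict Implicit.
Unset Printing Implicit Defensive.

Import Order.TTheory GRing.Theory Num.Theory.
Import numFieldNormedType.Exports.

Local Open Scope classical_set_scope.
Local Open Scope ring_scope.
Local Open Scope complex_scope.
Local Open Scope quotient_scope.

Section Nets.
Variable R : realType.

Definition eps_index := {e : R | 0 < e <= 1}.

Definition eps_one : eps_index := exist _ 1 (introT andP (conj ltr01 (lexx 1))).

HB.instance Definition _ := [Choice of eps_index by <:].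
HB.instance Definition _ := isPointed.Build eps_index eps_one.

Local Notation net := (eps_index -> R[i]).

Definition bigO_pow (c : net) (b : R) : Prop :=
  exists M eta : R, 0 < eta /\
    forall e : eps_index, val e < eta -> Normc.normc (c e) <= M * val e `^ b.

Lemma normc_ge0 (z : R[i]) : 0 <= Normc.normc z.
Proof. by case: z => a b; rewrite /= sqrtr_ge0. Qed.

Lemma bigO_powP (c : net) (b : R) : bigO_pow c b ->
  exists M eta : R, [/\ 0 <= M, 0 < eta &
    forall e : eps_index, val e < eta -> Normc.normc (c e) <= M * val e `^ b].
Proof.
move=> [M [eta [eta0 H]]]; exists `|M|, eta; split=> // e /H /le_trans; apply.
by rewrite ler_wpM2r ?powR_ge0// ler_norm.
Qed.

Lemma bigO_pow_le (c : net) (a b : R) : a <= b -> bigO_pow c b -> bigO_pow c a.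
Proof.
move=> ab /bigO_powP[M [eta [M0 eta0 H]]]; exists M, eta; split=> // e /H.
move=> /le_trans; apply; rewrite ler_wpM2l//.
case: e => e /= /andP[e0 e1]; rewrite /powR (gt_eqF e0) ler_expR.
by rewrite ler_wnM2r// ln_le0.
Qed.

Lemma bigO_pow0 (b : R) : bigO_pow 0 b.
Proof.
by exists 0, 1; split=> // e _; rewrite mul0r Normc.normc0.
Qed.

Lemma bigO_powD (c d : net) (b : R) :
  bigO_pow c b -> bigO_pow d b -> bigO_pow (c + d) b.
Proof.
move=> [M [eta [eta0 H]]] [M' [eta' [eta0' H']]].
exists (M + M'), (Num.min eta eta'); split; first by rewrite lt_min eta0.
move=> e; rewrite lt_min => /andP[/H He /H' He'].
by rewrite mulrDl (le_trans (le_normcD _ _))// lerD.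
Qed.

Lemma bigO_powN (c : net) (b : R) : bigO_pow c b -> bigO_pow (- c) b.
Proof.
move=> [M [eta [eta0 H]]]; exists M, eta; split=> // e /H.
by rewrite normcN.
Qed.

Lemma bigO_powM (c d : net) (a b : R) :
  bigO_pow c a -> bigO_pow d b -> bigO_pow (c * d) (a + b).
Proof.
move=> /bigO_powP[M [eta [M0 eta0 H]]] /bigO_powP[M' [eta' [M0' eta0' H']]].
exists (M * M'), (Num.min eta eta'); split; first by rewrite lt_min eta0.
move=> e; rewrite lt_min => /andP[/H He /H' He'].
have e_neq0 : val e != 0 by case: e {He He'} => e /= /andP[/gt_eqF ->].
rewrite powRD ?e_neq0 ?implybT// mulrACA Normc.normcM.
by rewrite ler_pM ?normc_ge0.
Qed.

Lemma bigO_pow1 : bigO_pow 1 0.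
Proof.
by exists 1, 1; split=> // e _; rewrite powRr0 mulr1 Normc.normc1.
Qed.

Lemma bigO_pow1_le0 (b : R) : bigO_pow 1 b -> b <= 0.
Proof.
move=> /bigO_powP[M [eta [M0 eta0 H]]]; rewrite leNgt; apply/negP => b0.
pose d := (M + 1)^-1 `^ b^-1.
have M1 : 0 < M + 1 by rewrite ltr_wpDl.
have d0 : 0 < d by rewrite powR_gt0 ?invr_gt0.
pose e := Num.min d (Num.min (eta / 2) 1).
have e0 : 0 < e by rewrite !lt_min d0 divr_gt0//= ltr01.
have e1 : e <= 1 by rewrite !ge_min lexx !orbT.
have He : 0 < e <= 1 by rewrite e0.
have /= := H (exist _ e He).
have -> : (e < eta).
  by rewrite /e !gt_min ltr_pdivrMr// ltr_pMr// ltr1n orbT.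
move=> /(_ isT); apply/negP; rewrite -ltNge.
rewrite [ltRHS](_ : _ = 1); last exact: Normc.normc1.
apply: (@le_lt_trans _ _ (M * d `^ b)).
  have ed : e <= d by rewrite ge_min lexx.
  by rewrite ler_wpM2l// ge0_ler_powR ?nnegrE ?(ltW b0) ?(ltW d0) ?(ltW e0).
rewrite /d -powRrM mulVf ?gt_eqF// powRr1 ?invr_ge0 ?ltW//.
by rewrite ltr_pdivrMr// mul1r ltrDl.
Qed.

Lemma bigO_pow_powR (b : R) :
  bigO_pow (fun e : eps_index => (val e `^ b)%:C) b.
Proof.
exists 1, 1; split=> // e _; rewrite mul1r /= expr0n addr0 sqrtr_sqr.
by rewrite ger0_norm ?powR_ge0.
Qed.

Definition moderate : {pred net} :=
  fun c => `[< exists N : nat, bigO_pow c (- N%:R) >].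

Lemma moderateP (c : net) :
  reflect (exists b : R, bigO_pow c b) (c \in moderate).
Proof.
apply: (iffP (asboolP _)) => [[N cN]|[b cb]]; first by exists (- N%:R).
exists (Num.bound `|b|); apply: bigO_pow_le cb.
by rewrite lerNl (le_trans (ler_norm _))// normrN ltW// archi_boundP.
Qed.

Lemma moderate_subring_closed : subring_closed moderate.
Proof.
split=> [|c d /moderateP[a ca] /moderateP[b db]|
          c d /moderateP[a ca] /moderateP[b db]]; apply/moderateP.
- by exists 0; exact: bigO_pow1.
- exists (Num.min a b); apply: bigO_powD.
    by apply: bigO_pow_le ca; rewrite ge_min lexx.
  by apply: bigO_powN; apply: bigO_pow_le db; rewrite ge_min lexx orbT.
- by exists (a + b); exact: bigO_powM.
Qed.

HB.instance Definition _ :=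
  GRing.isSubringClosed.Build net moderate moderate_subring_closed.

Record moderate_net := ModerateNet {
  net_of :> net ;
  net_of_moderate : net_of \in moderate
}.

HB.instance Definition _ := [isSub of moderate_net for net_of].
HB.instance Definition _ := [Choice of moderate_net by <:].
HB.instance Definition _ := [SubChoice_isSubComNzRing of moderate_net by <:].

Definition negligible : {pred moderate_net} :=
  fun c => `[< forall q : nat, bigO_pow (val c) q%:R >].

Lemma negligibleP (c : moderate_net) :
  reflect (forall b : R, bigO_pow (val c) b) (c \in negligible).
Proof.
apply: (iffP (asboolP _)) => [cN b|cN q]; last exact: cN.
apply: bigO_pow_le (cN (Num.bound `|b|)).
by rewrite (le_trans (ler_norm _))// ltW// archi_boundP.
Qed.

Lemma negligible_idealr_closed : idealr_closed negligible.
Proof.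
split=> [||c x y /negligibleP xN /negligibleP yN].
- by apply/negligibleP => b; rewrite raddf0; exact: bigO_pow0.
- apply/negP => /negligibleP/(_ 1); rewrite rmorph1 => /bigO_pow1_le0.
  by rewrite leNgt ltr01.
apply/negligibleP => b; rewrite rmorphD rmorphM; apply: bigO_powD => //.
have /moderateP[a ca] := valP c.
by rewrite -(subrKC a b); apply: bigO_powM.
Qed.

HB.instance Definition _ :=
  isIdealr.Build moderate_net negligible negligible_idealr_closed.

Definition gencomplex := {ideal_quot negligible}.

HB.instance Definition _ := GRing.ComNzRing.on gencomplex.

Definition genclass (c : moderate_net) : gencomplex :=
  \pi_{ideal_quot negligible} c.

(* Independent of the representative, see valuation_genclass. *)
Definition valuation (x : gencomplex) : \bar R :=
  ereal_sup [set b%:E | b in [set b : R | bigO_pow (val (repr x)) b]].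

Lemma valuation_genclass (c : moderate_net) :
  valuation (genclass c) =
  ereal_sup [set b%:E | b in [set b : R | bigO_pow (val c) b]].
Proof.
have cN : repr (genclass c) - c \in negligible.
  by rewrite Quotient.idealrBE reprK.
rewrite /valuation; congr (ereal_sup [set _ | _ in _]).
apply/seteqP; split=> b /= Hb; move: (negligibleP _ cN b).
  move=> /bigO_powN/(bigO_powD Hb); congr bigO_pow.
  by rewrite rmorphB /= opprB addrC subrK.
by move=> /bigO_powD/(_ Hb); rewrite rmorphB /= subrK.
Qed.

Lemma valuation_ge (c : moderate_net) (b : R) :
  bigO_pow (val c) b -> (b%:E <= valuation (genclass c))%E.
Proof.
by move=> cb; rewrite valuation_genclass; apply: ereal_sup_ubound; exists b.
Qed.

Lemma valuation_gt (c : moderate_net) (x : \bar R) :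
  (x < valuation (genclass c))%E ->
  exists2 b : R, bigO_pow (val c) b & (x < b%:E)%E.
Proof.
by rewrite valuation_genclass => /ereal_sup_gt[_ [b /= cb <-] xb]; exists b.
Qed.

Lemma genclass_surj (x : gencomplex) : exists c, x = genclass c.
Proof. by exists (repr x); rewrite /genclass reprK. Qed.

Lemma genclassD (c d : moderate_net) :
  genclass (c + d) = genclass c + genclass d.
Proof. by rewrite /genclass !piE. Qed.

Lemma genclassN (c : moderate_net) : genclass (- c) = - genclass c.
Proof. by rewrite /genclass !piE. Qed.

Lemma genclass0 : genclass 0 = 0.
Proof. by rewrite /genclass !piE. Qed.

Lemma genclass_eq0 (c : moderate_net) :
  genclass c = 0 <-> c \in negligible.
Proof.
rewrite -genclass0 -[c in X in _ <-> X]subr0 Quotient.idealrBE.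
by split=> [/eqP|/eqP].
Qed.

Lemma valuation_gtNy (x : gencomplex) : (-oo < valuation x)%E.
Proof.
have [c ->] := genclass_surj x.
have /moderateP[b cb] := net_of_moderate c.
exact: lt_le_trans (ltNyr b) (valuation_ge cb).
Qed.

Lemma valuationD (x y : gencomplex) :
  (Order.min (valuation x) (valuation y) <= valuation (x + y)%R)%E.
Proof.
have [c ->] := genclass_surj x; have [d ->] := genclass_surj y.
rewrite -genclassD leNgt lt_min; apply/negP => /andP[].
move=> /valuation_gt[a ca lta] /valuation_gt[b db ltb].
have /valuation_ge : bigO_pow (val (c + d)) (Num.min a b).
  rewrite raddfD; apply: bigO_powD.
    by apply: bigO_pow_le ca; rewrite ge_min lexx.
  by apply: bigO_pow_le db; rewrite ge_min lexx orbT.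
by rewrite EFin_min leNgt lt_min lta ltb.
Qed.

Lemma valuationN (x : gencomplex) : valuation (- x) = valuation x.
Proof.
have [c ->] := genclass_surj x; rewrite -genclassN !valuation_genclass.
rewrite raddfN; congr (ereal_sup [set _ | _ in _]); apply/seteqP.
by split=> b /= /bigO_powN; rewrite ?opprK.
Qed.

Lemma valuation_eqy (x : gencomplex) : valuation x = +oo%E <-> x = 0.
Proof.
have [c ->] := genclass_surj x; rewrite genclass_eq0; split.
  move=> supy; apply/negligibleP => b.
  have /valuation_gt[a ca] : (b%:E < valuation (genclass c))%E.
    by rewrite supy ltry.
  by rewrite lte_fin => /ltW ba; exact: bigO_pow_le ba ca.
move=> /negligibleP cN; have := valuation_gtNy (genclass c).
case E : (valuation _) => [r| |]// _.
have := valuation_ge (cN (r + 1)).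
by rewrite E lee_fin gerDl ler10.
Qed.

(* e^{-v(x)}; fine loses nothing, since v(x) > -oo (valuation_gtNy). *)
Definition sharp_norm (x : gencomplex) : R := fine (expeR (- valuation x)%E).

Lemma sharp_norm_fin (x : gencomplex) : expeR (- valuation x)%E \is a fin_num.
Proof.
by have := valuation_gtNy x; case: (valuation x).
Qed.

Lemma sharp_norm_eq0 (x : gencomplex) : sharp_norm x = 0 <-> x = 0.
Proof.
rewrite -valuation_eqy /sharp_norm; have := valuation_gtNy x.
by case: (valuation x) => [r| |] //= _; split=> // /eqP; rewrite gt_eqF ?expR_gt0.
Qed.

Lemma sharp_norm_ge0 (x : gencomplex) : 0 <= sharp_norm x.
Proof. by rewrite fine_ge0// expeR_ge0. Qed.

Lemma sharp_normN (x : gencomplex) : sharp_norm (- x) = sharp_norm x.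
Proof. by rewrite /sharp_norm valuationN. Qed.

Lemma sharp_normD (x y : gencomplex) :
  sharp_norm (x + y) <= Num.max (sharp_norm x) (sharp_norm y).
Proof.
have := valuationD x y; rewrite ge_min le_max => /orP[] xy; apply/orP.
  by left; rewrite fine_le ?sharp_norm_fin// lee_expeR leeN2.
by right; rewrite fine_le ?sharp_norm_fin// lee_expeR leeN2.
Qed.

Definition sharp_dist (x y : gencomplex) : R := sharp_norm (x - y).

Lemma sharp_distxx (x : gencomplex) : sharp_dist x x = 0.
Proof. by apply/sharp_norm_eq0; rewrite subrr. Qed.

Lemma sharp_dist_positivity (x y : gencomplex) : sharp_dist x y = 0 -> x = y.
Proof. by move/sharp_norm_eq0/eqP; rewrite subr_eq0 => /eqP. Qed.

Lemma sharp_dist_sym (x y : gencomplex) : sharp_dist x y = sharp_dist y x.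
Proof. by rewrite /sharp_dist -opprB sharp_normN. Qed.

Lemma sharp_dist_triangle (y x z : gencomplex) :
  sharp_dist x z <= sharp_dist x y + sharp_dist y z.
Proof.
rewrite /sharp_dist -(subrKA y x (- z)) (le_trans (sharp_normD _ _))//.
by rewrite ge_max lerDl lerDr !sharp_norm_ge0.
Qed.

HB.instance Definition _ := @isMetric.Build R gencomplex sharp_dist
  sharp_distxx sharp_dist_positivity sharp_dist_sym sharp_dist_triangle.

Lemma powR_moderate (b : R) :
  (fun e : eps_index => (val e `^ b)%:C) \in moderate.
Proof. by apply/moderateP; exists b; exact: bigO_pow_powR. Qed.

Definition gen_eps (b : R) : gencomplex :=
  genclass (ModerateNet (powR_moderate b)).

End Nets.

Section Modules.
Variable R : realType.

Section Submodule.
Variables (V : lmodType (gencomplex R)) (S : submodClosed V).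

Record submod := Submod { submod_val :> V ; submod_in : submod_val \in S }.

HB.instance Definition _ := [isSub of submod for submod_val].
HB.instance Definition _ := [Choice of submod by <:].
HB.instance Definition _ := [SubChoice_isSubLmodule of submod by <:].

End Submodule.

(* A topology on T is an inhabitant of the library's class Topological T, so
   that several topologies on one module can be compared. *)
Definition tspace (T : Type) (tau : Topological T) : topologicalType :=
  Topological.Pack tau.

Section Topology.
Variable V : lmodType (gencomplex R).
Implicit Types (A : set V) (tau : Topological V).

Definition balanced A : Prop :=
  forall (l : gencomplex R) (x : V), sharp_norm l <= 1 -> A x -> A (l *: x).

Definition gen_convex A : Prop :=
  (forall x y : V, A x -> A y -> A (x + y)) /\
  (forall (b : R) (x : V), 0 <= b -> A x -> A (gen_eps b *: x)).

Definition absolutely_convex A : Prop := balanced A /\ gen_convex A.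

Definition linear_topology tau : Prop :=
  continuous (fun z : tspace tau * tspace tau =>
    (z.1 : V) + (z.2 : V) : tspace tau) /\
  continuous (fun z : gencomplex R * tspace tau =>
    z.1 *: (z.2 : V) : tspace tau).

Definition gen_locally_convex tau : Prop :=
  forall U : set V, nbhs (0 : tspace tau) U ->
    exists C : set V, [/\ nbhs (0 : tspace tau) C, gen_convex C & C `<=` U].

Definition lc_topology tau : Prop := linear_topology tau /\ gen_locally_convex tau.

(* Only nonempty index lists matter: C(n_1,...,n_k) is W [:: n_1; ...; n_k],
   and the index set N \ 0 is relabelled as nat by shifting by one. *)
Definition is_web (W : seq nat -> set V) : Prop :=
  \bigcup_n W [:: n] = setT /\
  forall (n : nat) (s : seq nat), W (n :: s) = \bigcup_m W (n :: rcons s m).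

Definition absolutely_convex_web (W : seq nat -> set V) : Prop :=
  forall (n : nat) (s : seq nat), absolutely_convex (W (n :: s)).

(* Sequences indexed by k >= 1 are indexed here by k >= 0: the paper's n_{k+1}
   is n k, so C(n_1,...,n_{k+1}) is W (mkseq n k.+1). *)
Definition type_C tau (W : seq nat -> set V) : Prop :=
  forall n : nat -> nat, exists rho : nat -> R,
  forall (lambda : nat -> R) (x : nat -> V),
    (forall k, rho k <= lambda k) ->
    (forall k, W (mkseq n k.+1) (x k)) ->
    exists l : tspace tau,
      (series (fun k => gen_eps (lambda k) *: x k) : nat -> tspace tau)
        @ \oo --> l.

End Topology.

Section StrictInductiveLimit.
Variables (V : lmodType (gencomplex R)) (G : nat -> submodClosed V).
Variable tauG : forall p, Topological (submod (G p)).

Definition inclusions_continuous (tau : Topological V) : Prop :=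
  forall p, continuous (fun x : tspace (tauG p) =>
    submod_val (x : submod (G p)) : tspace tau).

(* tau_{p+1} induces tau_p on G_p, both being compared inside V. *)
Definition induces (p : nat) : Prop :=
  forall U : set (submod (G p)),
    open (U : set (tspace (tauG p))) <->
    exists U' : set (submod (G p.+1)),
      open (U' : set (tspace (tauG p.+1))) /\
      [set submod_val x | x in U] =
        [set submod_val y | y in U'] `&` [set z | z \in G p].

(* The sequence (G_p)_{p >= 1} is indexed here from 0. *)
Record strict_inductive_limit (tau : Topological V) : Prop := {
  sil_increasing : forall p, {subset G p <= G p.+1} ;
  sil_cover : forall x : V, exists p, x \in G p ;
  sil_lc : forall p, lc_topology (tauG p) ;
  sil_induces : forall p, induces p ;
  sil_lc_limit : lc_topology tau ;
  sil_continuous : inclusions_continuous tau ;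
  sil_finest : forall tau' : Topological V,
    lc_topology tau' -> inclusions_continuous tau' ->
    forall A : set V, open (A : set (tspace tau')) ->
      open (A : set (tspace tau))
}.

End StrictInductiveLimit.
End Modules.

(* Main.v *)
Require Import Defs.
From mathcomp Require Import all_boot all_order all_algebra.
From mathcomp Require Import all_classical all_reals all_analysis.

(** Every point of [V] lies in some [G p], and [G p] is exhausted by its own
    web; so a web on [V] is obtained by letting the first index choose the step
    [p], and the remaining indices run through the web of [G p]:
      C(p) = G_p   and   C(p, n_1, ..., n_k) = C_p(n_1, ..., n_k).

    A branch of this web starting with [p] therefore stays in the single module
    [G p].  A series along it is a single term followed by a series along a
    branch of the web of [G p].  The latter converges in [G p], hence in [V] by
    continuity of the linear inclusion ([cvg_series_inclusion]), and adding one
    term is harmless by continuity of addition ([cvg_series_behead]).  Absolute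
    convexity holds for the submodules [G p], and it passes to linear images. *)

Set Implicit Arguments.
Unset Strict Implicit.
Unset Printing Implicit Defensive.

Import Order.TTheory GRing.Theory Num.Theory.

Local Open Scope classical_set_scope.
Local Open Scope ring_scope.

Section AbsoluteConvexity.
Variable R : realType.

Lemma absolutely_convex_image (U V : lmodType (gencomplex R))
    (f : {linear U -> V}) (A : set U) :
  absolutely_convex A -> absolutely_convex (f @` A).
Proof.
move=> [balA [addA epsA]]; split; last split.
- move=> l _ l1 [x Ax <-]; exists (l *: x); first exact: balA.
  by rewrite linearZ.
- move=> _ _ [x Ax <-] [y Ay <-]; exists (x + y); first exact: addA.
  by rewrite linearD.
- move=> b _ b0 [x Ax <-]; exists (gen_eps b *: x); first exact: epsA.
  by rewrite linearZ.
Qed.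

Lemma absolutely_convex_submodule (V : lmodType (gencomplex R))
    (S : submodClosed V) :
  absolutely_convex [set x : V | x \in S].
Proof.
by split=> [l x _|]; [|split=> [x y|b x _]]; move=> /= *; rewrite ?rpredZ ?rpredD.
Qed.

End AbsoluteConvexity.

Section ConvergenceOfSeries.
Variables (R : realType) (V : lmodType (gencomplex R)).

Lemma cvg_series_behead (tau : Topological V) (u : nat -> V) (l : tspace tau) :
  linear_topology tau ->
  (series (fun k => u k.+1) : nat -> tspace tau) @ \oo --> l ->
  (series u : nat -> tspace tau) @ \oo --> ((u 0%N + (l : V)) : tspace tau).
Proof.
move=> [addC _] ul.
have shifted : (fun n => series u n.+1 : tspace tau) @ \oo -->
    (u 0%N + (l : V) : tspace tau).
  have -> : (fun n => series u n.+1) =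
      (fun n => u 0%N + series (fun k => u k.+1) n).
    by apply/funext => n; rewrite /series /= big_nat_recl.
  apply: (@cvg_comp _ _ _
    (fun n => ((u 0%N : tspace tau),
               (series (fun k => u k.+1) n : tspace tau)))
    (fun z : tspace tau * tspace tau => (z.1 : V) + (z.2 : V) : tspace tau)
    _ (nbhs ((u 0%N : tspace tau), l)) _ _ (addC _)).
  by apply: cvg_pair => //; exact: cvg_cst.
have := @cvg_comp _ _ _ (subn^~ 1%N) (fun n => series u n.+1 : tspace tau)
  _ _ _ (cvg_subnr 1) shifted.
by apply: cvg_trans; apply: near_eq_cvg; exists 1%N => // n /= n0; rewrite subn1 prednK.
Qed.

Lemma cvg_series_inclusion (S : submodClosed V)
    (sigma : Topological (submod S)) (tau : Topological V)
    (u : nat -> submod S) (l : tspace sigma) :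
  continuous (fun x : tspace sigma =>
    submod_val (x : submod S) : tspace tau) ->
  (series u : nat -> tspace sigma) @ \oo --> l ->
  (series (fun k => submod_val (u k)) : nat -> tspace tau) @ \oo -->
    (submod_val (l : submod S) : tspace tau).
Proof.
move=> inclC ul.
have -> : series (fun k => submod_val (u k)) =
    (fun n => submod_val (series u n)).
  by apply/funext => n; rewrite /series /= -[RHS]/(\val _) raddf_sum.
exact: (@cvg_comp _ _ _ (series u : nat -> tspace sigma)
  (fun x : tspace sigma => submod_val (x : submod S) : tspace tau)
  _ _ _ ul (inclC l)).
Qed.

End ConvergenceOfSeries.

Section UnionWeb.
Variables (R : realType) (V : lmodType (gencomplex R)).
Variables (G : nat -> submodClosed V).
Variable W : forall p : nat, seq nat -> set (submod (G p)).
Arguments W : clear implicits.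

(** One-letter words need their own clause: a web is constrained only on
    nonempty words, so [W p [::]] may be any set. *)
Definition union_web (s : seq nat) : set V :=
  match s with
  | [::] => setT
  | [:: p] => [set x | x \in G p]
  | p :: s => [set submod_val x | x in W p s]
  end.

Lemma is_web_union_web :
  (forall x : V, exists p, x \in G p) ->
  (forall p, is_web (W p)) -> is_web union_web.
Proof.
move=> Gcover Wweb; split.
  by apply/seteqP; split=> // x _; have [p xp] := Gcover x; exists p.
move=> p [|n s]; have [Wcover Wsplit] := Wweb p.
- apply/seteqP; split=> [x xp|x [m _ [y _ <-]]]; last exact: submod_in.
  have : (\bigcup_n W p [:: n]) (Submod xp) by rewrite Wcover.
  by move=> [m _ Wm]; exists m => //; exists (Submod xp).
- by rewrite /= Wsplit image_bigcup.
Qed.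

Lemma type_C_union_web (tauG : forall p, Topological (submod (G p)))
    (tau : Topological V) :
  linear_topology tau -> inclusions_continuous tauG tau ->
  (forall p, type_C (tauG p) (W p)) -> type_C tau union_web.
Proof.
move=> tau_lin inclC WC n.
have [rho rhoP] := WC (n 0%N) (fun k => n k.+1).
(* The web of [G (n 0)] only sees the terms from index 1 on; one term more or
   less does not affect convergence, so any bound will do at index 0. *)
exists (fun k => if k is k'.+1 then rho k' else 0) => lambda x lambdaP xP.
have /choice[y yP] : forall k, exists y : submod (G (n 0%N)),
    W (n 0%N) (mkseq (fun k => n k.+1) k.+1) y /\ submod_val y = x k.+1.
  move=> k; have := xP k.+1.
  have -> : mkseq n k.+2 = n 0%N :: mkseq (fun k => n k.+1) k.+1.
    by rewrite /mkseq /= -[2%N]/(1 + 1)%N iotaDl -map_comp.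
  by move=> [z Wz zx]; exists z.
have [l yl] := rhoP (fun k => lambda k.+1) y
  (fun k => lambdaP k.+1) (fun k => (yP k).1).
exists (gen_eps (lambda 0%N) *: x 0%N + submod_val (l : submod (G (n 0%N)))).
apply: (cvg_series_behead tau_lin).
have -> : (fun k => gen_eps (lambda k.+1) *: x k.+1) =
    (fun k => submod_val (gen_eps (lambda k.+1) *: y k)).
  by apply/funext => k; rewrite -(yP k).2 -[RHS]/(\val _) linearZ.
exact: cvg_series_inclusion (inclC (n 0%N)) yl.
Qed.

Lemma absolutely_convex_union_web :
  (forall p, absolutely_convex_web (W p)) -> absolutely_convex_web union_web.
Proof.
move=> Wac p [|n s]; first exact: absolutely_convex_submodule.
have := Wac p n s.
exact: (@absolutely_convex_image _ _ _ (\val : {linear submod (G p) -> V})).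
Qed.

End UnionWeb.

Theorem proposition1p14 (R : realType) (V : lmodType (gencomplex R))
    (G : nat -> submodClosed V)
    (tauG : forall p : nat, Topological (submod (G p)))
    (tau : Topological V)
    (W : forall p : nat, seq nat -> set (submod (G p))) :
  strict_inductive_limit tauG tau ->
  (forall p : nat, is_web (W p) /\ type_C (tauG p) (W p)) ->
  exists W' : seq nat -> set V,
    is_web W' /\ type_C tau W' /\
    ((forall p : nat, absolutely_convex_web (W p)) ->
     absolutely_convex_web W').
Proof.
move=> [_ Gcover _ _ [tau_lin _] inclC _] WP; exists (union_web W).
split; first by apply: is_web_union_web => // p; have [] := WP p.
split; last exact: absolutely_convex_union_web.
by apply: (type_C_union_web tau_lin inclC) => p; have [] := WP p.
Qed.
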